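(* Let $k\ge2$ and let $\mathcal{C}$ be a nondegenerate $[(k-1)m,k]_{q^m/q}$ code with linearity index $\ell=\ell(\mathcal{C})$. The following are equivalent. (1) $\mathcal{C}$ is minimal. (2) $\ell<k-2$. (3) $d^{\mathrm{rk}}_2(\mathcal{C})>m$.
   Context: Let $q$ be a prime power and $n,m,k$ positive integers. For $v\in\mathbb{F}_{q^m}^n$ and an ordered basis $\Gamma=(\gamma_1,\dots,\gamma_m)$ of $\mathbb{F}_{q^m}$ over $\mathbb{F}_q$, let $\Gamma(v)\in\mathbb{F}_q^{n\times m}$ be the matrix with $v_i=\sum_{j}\Gamma(v)_{ij}\gamma_j$. The rank support $\sigma^{\mathrm{rk}}(v)\subseteq\mathbb{F}_q^n$ is the column space of $\Gamma(v)$ (independent of $\Gamma$). An $[n,k]_{q^m/q}$ code is a $k$-dimensional $\mathbb{F}_{q^m}$-subspace $\mathcal{C}\subseteq\mathbb{F}_{q^m}^n$; it is nondegenerate if $\sum_{v\in\mathcal{C}}\sigma^{\mathrm{rk}}(v)=\mathbb{F}_q^n$, and minimal if for all $v,v'\in\mathcal{C}$, $\sigma^{\mathrm{rk}}(v')\subseteq\sigma^{\mathrm{rk}}(v)$ implies $v'=\alpha v$ for some $\alpha\in\mathbb{F}_{q^m}$. For a nondegenerate code $\mathcal{C}$ with generator matrix $G\in\mathbb{F}_{q^m}^{k\times n}$, let $\mathcal{U}\subseteq\mathbb{F}_{q^m}^k$ be the $\mathbb{F}_q$-span of the columns of $G$. The linearity index of $\mathcal{C}$ is $\ell(\mathcal{C})=\max\{\dim_{\mathbb{F}_{q^m}}(H):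 H\subseteq\mathbb{F}_{q^m}^k \text{ an } \mathbb{F}_{q^m}\text{-subspace with } H\subseteq\mathcal{U}\}$; it does not depend on the choice of $G$. Let $\theta$ be the map $x\mapsto x^q$ applied componentwise to $\mathbb{F}_{q^m}^n$, and let $\Lambda_q(n,m)$ be the set of $\mathbb{F}_{q^m}$-subspaces $\mathcal{V}\le\mathbb{F}_{q^m}^n$ with $\theta(\mathcal{V})=\mathcal{V}$. For $1\le r\le k$, the $r$-th generalized rank weight is $d^{\mathrm{rk}}_r(\mathcal{C})=\min\{\dim_{\mathbb{F}_{q^m}}(\mathcal{V}):\mathcal{V}\in\Lambda_q(n,m),\ \dim_{\mathbb{F}_{q^m}}(\mathcal{V}\cap\mathcal{C})\ge r\}$. *)

(* Defs.v *)
From mathcomp Require Import all_boot all_order all_algebra all_field.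
From mathcomp Require Import boolp.

Set Implicit Arguments.
Unset Strict Implicit.
Unset Printing Implicit Defensive.

Import GRing.Theory.
Local Open Scope ring_scope.

(* F plays the role of F_q with q = #|F|, and the extension L of degree
   m = \dim {:L} that of F_{q^m}; Gamma is an ordered F-basis of L. *)

Definition expansion_mx (F : finFieldType) (L : fieldExtType F) (n m : nat)
    (Gamma : m.-tuple L) (v : 'rV[L]_n) : 'M[F]_(n, m) :=
  \matrix_(i < n, j < m) coord Gamma j (v 0 i).

Definition rank_support (F : finFieldType) (L : fieldExtType F) (n m : nat)
    (Gamma : m.-tuple L) (v : 'rV[L]_n) : {vspace 'cV[F]_n} :=
  <<[seq col j (expansion_mx Gamma v) | j : 'I_m]>>%VS.

(* finvect_type L is L with its finite type structure, which makes the set of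
   codewords a legitimate range for the sum of subspaces. *)
Definition rk_nondegenerate (F : finFieldType) (L : fieldExtType F) (n m : nat)
    (Gamma : m.-tuple L) (C : {vspace 'rV[L]_n}) : Prop :=
  (\sum_(v : 'rV[finvect_type L]_n | (v : 'rV[L]_n) \in C)
      rank_support Gamma (v : 'rV[L]_n))%VS = fullv.

Definition minimal_code (F : finFieldType) (L : fieldExtType F) (n m : nat)
    (Gamma : m.-tuple L) (C : {vspace 'rV[L]_n}) : Prop :=
  forall v v' : 'rV[L]_n, v \in C -> v' \in C ->
    (rank_support Gamma v' <= rank_support Gamma v)%VS ->
    exists alpha : L, v' = alpha *: v.

Definition generator_matrix (L : fieldType) (k n : nat)
    (C : {vspace 'rV[L]_n}) (G : 'M[L]_(k, n)) : Prop :=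
  basis_of C [seq row i G | i : 'I_k].

Definition in_col_span (F : finFieldType) (L : fieldExtType F) (k n : nat)
    (G : 'M[L]_(k, n)) (w : 'cV[L]_k) : Prop :=
  exists a : 'I_n -> F, w = \sum_(j < n) (a j)%:A *: col j G.

(* The dimension of a subspace of L^k is at most k, so ranging over d < k.+1
   loses nothing; d = 0 always qualifies. *)
Definition linearity_index (F : finFieldType) (L : fieldExtType F) (k n : nat)
    (G : 'M[L]_(k, n)) : nat :=
  \max_(d < k.+1 | `[< exists H : {vspace 'cV[L]_k},
      (forall w, w \in H -> in_col_span G w) /\ \dim H = d >]) d.

Definition frob_row (F : finFieldType) (L : fieldExtType F) (n : nat)
    (v : 'rV[L]_n) : 'rV[L]_n :=
  map_mx (fun x : L => x ^+ #|F|) v.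

Definition Frobenius_closed (F : finFieldType) (L : fieldExtType F) (n : nat)
    (V : {vspace 'rV[L]_n}) : Prop :=
  forall w : 'rV[L]_n, w \in V <-> exists2 v, v \in V & w = frob_row v.

(* For r <= \dim C the default value n of the minimum is the dimension of the
   admissible subspace V = L^n, so it does not affect the result. *)
Definition gen_rank_weight (F : finFieldType) (L : fieldExtType F) (n : nat)
    (r : nat) (C : {vspace 'rV[L]_n}) : nat :=
  \big[minn/n]_(d < n.+1 | `[< exists V : {vspace 'rV[L]_n},
      [/\ Frobenius_closed V, (r <= \dim (V :&: C))%N & \dim V = d] >]) d.

(* Main.v *)
(* Call a pencil light if it is a two-dimensional subcode contained in the
   extension of scalars of an F-subspace of F^n of dimension at most m. For any
   code, minimality fails exactly when there is a light pencil: the support of a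
   single codeword has dimension at most m, so two independent codewords with
   nested supports span a light pencil; conversely, among the q^m combinations
   x0 + t x1 in a light pencil one must have the whole support of the pencil,
   since a witness to the contrary would be a nonzero vector of F^m depending
   injectively on t. By Galois descent, d_2 <= m also says that a light pencil
   exists. Finally, for n = (k - 1) m, the vectors of U killed by a light pencil
   form an F-space of dimension at least (k - 2) m inside an L-space of
   dimension k - 2, so they fill it; reading this backwards turns a
   (k - 2)-dimensional L-subspace of U into a light pencil. *)

Require Import Defs.
From mathcomp Require Import all_boot all_order all_algebra all_field.
From mathcomp Require Import boolp.

Set Implicit Arguments.
Unset Strict Implicit.
Unset Printing Implicit Defensive.

Import GRing.Theory.
Local Open Scope ring_scope.

Local Notation "A ^L" := (map_mx (in_alg _) A) (at level 2, format "A ^L").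

(** * Comparing coordinate spaces over [F] and [L] by cardinality *)

Section Counting.
Variables (F : finFieldType) (L : fieldExtType F).

Lemma card_ext : #|finvect_type L| = (#|F| ^ \dim {:L})%N.
Proof.
by rewrite -(card_vspacef (Vector.class (finvect_type L))) card_vspace.
Qed.

Lemma card_cV_ext (b : nat) :
  #|{: 'cV[finvect_type L]_b}| = (#|F| ^ (\dim {:L} * b))%N.
Proof. by rewrite card_mx muln1 expnM card_ext. Qed.

Lemma card_field_gt1 : (1 < #|F|)%N.
Proof. exact: finNzRing_gt1. Qed.

(** Counting points instead of dimensions admits maps that are not known to be linear, such as those
    made by choosing preimages. *)
Lemma leq_dim_inj (a b : nat) (f : 'cV[L]_b -> 'cV[F]_a) :
  injective f -> (\dim {:L} * b <= a)%N.
Proof.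
move=> f_inj; have := @leq_card 'cV[finvect_type L]_b _ f f_inj.
by rewrite card_cV_ext card_mx muln1 leq_exp2l ?card_field_gt1.
Qed.

Lemma inj_onto_ext (a b : nat) (f : 'cV[F]_a -> 'cV[L]_b) :
  injective f -> (\dim {:L} * b <= a)%N -> forall y, exists x, y = f x.
Proof.
move=> f_inj le_ba y.
have le_card : (#|{: 'cV[finvect_type L]_b}| <= #|{: 'cV[F]_a}|)%N.
  by rewrite card_cV_ext card_mx muln1 leq_exp2l ?card_field_gt1.
have /codomP[x ->] := @inj_card_onto _ 'cV[finvect_type L]_b f f_inj le_card y.
by exists x.
Qed.

Lemma inj_onto_base (a b : nat) (f : 'cV[L]_b -> 'cV[F]_a) :
  injective f -> (a <= \dim {:L} * b)%N -> forall y, exists x, y = f x.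
Proof.
move=> f_inj le_ab y.
have le_card : (#|{: 'cV[F]_a}| <= #|{: 'cV[finvect_type L]_b}|)%N.
  by rewrite card_cV_ext card_mx muln1 leq_exp2l ?card_field_gt1.
have /codomP[x ->] := @inj_card_onto 'cV[finvect_type L]_b _ f f_inj le_card y.
by exists x.
Qed.

End Counting.

(** * Kernels, row spaces and independent families over a field *)

Section LinearAlgebra.
Variable K : fieldType.

(** The number of columns [s] is tied to the nullity by an equation, so that it can be [2] or
    [k - 2] without casts. *)
Lemma right_kernel (r n : nat) (B : 'M[K]_(r, n)) (s : nat) :
  s = (n - \rank B)%N ->
  exists N : 'M[K]_(n, s), [/\ B *m N = 0, row_free N^T &
    forall w : 'cV_n, B *m w = 0 -> exists c, w = N *m c].
Proof.
rewrite -mxrank_tr -mxrank_ker => ->.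
exists (row_base (kermx B^T))^T; split.
- apply: (can_inj (@trmxK _ _ _)); rewrite trmx_mul trmxK trmx0.
  by apply/sub_kermxP; rewrite eq_row_base.
- by rewrite trmxK row_base_free.
move=> w Bw0; have /submxP[c wE] : (w^T <= row_base (kermx B^T))%MS.
  by rewrite eq_row_base; apply/sub_kermxP; rewrite -trmx_mul Bw0 trmx0.
by exists c^T; rewrite -trmx_mul -wE trmxK.
Qed.

Lemma free_tr_inj (n s p : nat) (N : 'M[K]_(n, s)) :
  row_free N^T -> injective (fun c : 'M_(s, p) => N *m c).
Proof.
move=> Nfree c d /(congr1 trmx); rewrite !trmx_mul => /(row_free_inj Nfree).
exact: trmx_inj.
Qed.

Lemma mx2P (n : nat) (Y Y' : 'M[K]_(2, n)) :
  row 0 Y = row 0 Y' -> row 1 Y = row 1 Y' -> Y = Y'.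
Proof.
move=> e0 e1; apply/row_matrixP => i.
case: (unliftP 0 i) => [i'|] -> //; rewrite (ord1 i').
by have -> : lift 0 0 = 1 :> 'I_2 by apply: val_inj.
Qed.

Lemma mulmx_sum_col (n s : nat) (A : 'M[K]_(n, s)) (c : 'cV_s) :
  A *m c = \sum_j c j 0 *: col j A.
Proof.
apply/colP => i; rewrite mxE summxE.
by apply: eq_bigr => j _; rewrite !mxE mulrC.
Qed.

Lemma mul_rV2 (n : nat) (y : 'rV[K]_2) (X : 'M_(2, n)) :
  y *m X = y 0 0 *: row 0 X + y 0 1 *: row 1 X.
Proof.
rewrite mulmx_sum_row big_ord_recl big_ord1.
by have -> : lift 0 0 = 1 :> 'I_2 by apply: val_inj.
Qed.

Lemma row_free2 (n : nat) (x x' : 'rV[K]_n) :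
  (forall a, x' <> a *: x) -> x != 0 ->
  row_free (col_mx x x' : 'M_(2, n)).
Proof.
move=> nprop xn0; apply: inj_row_free => v.
have -> : v = row_mx (lsubmx (v : 'rV_(1 + 1))) (rsubmx (v : 'rV_(1 + 1))).
  by rewrite hsubmxK.
set a := lsubmx _; set b := rsubmx _.
rewrite (mul_row_col a b) [a]mx11_scalar [b]mx11_scalar !mul_scalar_mx.
move=> /eqP; case: (eqVneq (b 0 0) 0) => [->|bn0].
  rewrite scale0r addr0 scaler_eq0 (negPf xn0) orbF => /eqP ->.
  by rewrite !raddf0 row_mx0.
rewrite addrC addr_eq0 -scaleNr => /eqP e.
case: (nprop ((b 0 0)^-1 * (- a 0 0))).
by rewrite -scalerA -e scalerA mulVf ?scale1r.
Qed.

(** Testing on vectors over the small field [K] is enough: the cokernel of [map_mx f B] is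
    [cokermx B] mapped by [f], and the columns of [cokermx B] are killed by [B]. *)
Lemma row_sub_map (K' : fieldType) (f : {rmorphism K -> K'}) (s r n : nat)
    (Y : 'M[K']_(s, n)) (B : 'M[K]_(r, n)) :
  (forall a : 'cV[K]_n, B *m a = 0 -> Y *m map_mx f a = 0) ->
  (Y <= map_mx f B)%MS.
Proof.
move=> kerBY; rewrite submxE -map_cokermx; apply/eqP/trmx_inj/row_matrixP => j.
rewrite -tr_col colE -mulmxA -(map_delta_mx f) -map_mxM.
by rewrite kerBY ?trmx0 ?row0 // mulmxA mulmx_coker mul0mx.
Qed.

Lemma memv_span_family (vT : vectType K) (m : nat) (u : 'I_m -> vT) (v : vT) :
  v \in <<[seq u i | i : 'I_m]>>%VS <->
  exists c : 'I_m -> K, v = \sum_i c i *: u i.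
Proof.
pose X := [tuple u i | i < m]; change [seq u i | i : 'I_m] with (val X).
have XE (i : 'I_m) : X`_i = u i by rewrite -tnth_nth tnth_mktuple.
split=> [/coord_span vE | [c ->]].
  by exists (fun i => coord X i v); rewrite {1}vE; under eq_bigr do rewrite XE.
by apply: rpred_sum => i _; rewrite memvZ ?memv_span // -XE mem_nth ?size_tuple.
Qed.

Definition independent (vT : vectType K) (m : nat) (u : 'I_m -> vT) :=
  forall c : 'I_m -> K, \sum_i c i *: u i = 0 -> forall i, c i = 0.

Lemma free_family (vT : vectType K) (m : nat) (u : 'I_m -> vT) :
  free [seq u i | i : 'I_m] <-> independent u.
Proof.
pose X := [tuple u i | i < m]; change [seq u i | i : 'I_m] with (val X).
have XE (i : 'I_m) : X`_i = u i by rewrite -tnth_nth tnth_mktuple.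
split=> [/freeP Xfree c e i | ufree].
  by apply: Xfree; under eq_bigr do rewrite XE.
by apply/freeP => c e; apply: ufree; under eq_bigr do rewrite -XE.
Qed.

Lemma leq_dimvP (vT : vectType K) (s : nat) (W : {vspace vT}) :
  (s <= \dim W)%N <->
  exists2 u : 'I_s -> vT, independent u & forall i, u i \in W.
Proof.
split=> [le_s | [u /free_family ufree uW]].
  exists (fun i => (take s (vbasis W))`_i).
    have sz : size (take s (vbasis W)) == s by rewrite size_takel ?size_tuple.
    have : free (Tuple sz).
      apply: (@catl_free _ _ (drop s (vbasis W))).
      by rewrite cat_take_drop (basis_free (vbasisP W)).
    by move/freeP.
  move=> i; rewrite nth_take //; apply/vbasis_mem/mem_nth.
  by rewrite size_tuple (leq_trans _ le_s).
have <- : \dim <<[seq u i | i : 'I_s]>> = s.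
  by rewrite (eqP ufree) size_image card_ord.
by apply/dimvS/span_subvP => _ /imageP[i _ ->].
Qed.

End LinearAlgebra.

(** * Light pencils against minimality and against linear subspaces of U *)

Section Core.
Variables (F : finFieldType) (L : fieldExtType F).
Local Notation d := (\dim {:L}).

(** Coordinates in [Gamma] are [F]-linear, so the product on the right lists the coordinates of the
    single entry of [v *m a^L]. Supports can thus be handled through the [F]-vectors orthogonal to
    them. *)
Lemma expansion_mx_ker (m n : nat) (Gamma : m.-tuple L)
    (hGamma : basis_of {:L} Gamma) (v : 'rV[L]_n) (a : 'cV[F]_n) :
  v *m a^L = 0 <-> (expansion_mx Gamma v)^T *m a = 0.
Proof.
have coordE j :
    ((expansion_mx Gamma v)^T *m a) j 0 = coord Gamma j ((v *m a^L) 0 0).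
  rewrite !mxE linear_sum; apply: eq_bigr => i _.
  by rewrite !mxE mulr_algr linearZ /= mulrC.
split=> [va0 | Ma0].
  by apply/colP => j; rewrite coordE va0 !mxE linear0.
apply/matrixP => i j; rewrite !ord1 [RHS]mxE.
rewrite [LHS](coord_basis hGamma (memvf ((v *m a^L) 0 0))) big1 // => l _.
by rewrite -coordE Ma0 mxE scale0r.
Qed.

(** Inclusion of supports appears as the reverse inclusion of their orthogonals in [F^n], which
    removes [Gamma]. *)
Definition minimal_generator (k n : nat) (G : 'M[L]_(k, n)) :=
  forall x x' : 'rV[L]_k,
    (forall a : 'cV[F]_n, x *m G *m a^L = 0 -> x' *m G *m a^L = 0) ->
    exists alpha : L, x' = alpha *: x.

(** The rows of [X *m G] span the pencil, and the [L]-span of the rows of [B] is the extension of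
    scalars containing it. *)
Definition light_pencil (k n : nat) (G : 'M[L]_(k, n)) :=
  exists r (B : 'M[F]_(r, n)) (X : 'M[L]_(2, k)) (Z : 'M[L]_(2, r)),
    [/\ (r <= d)%N, row_free X & X *m G = Z *m B^L].

Definition big_linear_part (k n : nat) (G : 'M[L]_(k, n)) :=
  exists2 K : 'M[L]_(k, k - 2), row_free K^T &
    forall y : 'cV[L]_(k - 2), exists a : 'cV[F]_n, K *m y = G *m a^L.

Lemma light_pencil_not_minimal (k n : nat) (G : 'M[L]_(k, n)) :
  light_pencil G -> ~ minimal_generator G.
Proof.
case=> r [B [X [Z [le_rd Xfree XG]]]] minG.
pose z i (c : 'cV[F]_r) := (row i Z *m c^L) 0 0.
have xGE i (a : 'cV[F]_n) : (row i X *m G *m a^L) = (z i (B *m a))%:M.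
  by rewrite -row_mul XG row_mul -mulmxA -map_mxM [LHS]mx11_scalar.
(* The codewords x0 + t x1 are never multiples of x1, so minimality yields for
   each t a vector c_t killed by x0 + t x1 but not by x1; t is recovered from
   c_t, and there are too many t. *)
have bad (t : 'cV[L]_1) : {c | z 0 c + t 0 0 * z 1 c = 0 & z 1 c != 0}.
  apply: cid2; apply: contrapT => no_c.
  have [|alpha] := minG (row 0 X + t 0 0 *: row 1 X) (row 1 X).
    move=> a; rewrite mulmxDl mulmxDl -scalemxAl -scalemxAl !xGE => e.
    apply: contrapT => ne; apply: no_c; exists (B *m a).
      by move/matrixP/(_ 0 0): e; rewrite !mxE eqxx !mulr1n.
    by apply/eqP => z0; apply: ne; rewrite z0 raddf0.
  move=> /eqP; rewrite -subr_eq0 => /eqP e.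
  (* The coefficients of x0 and x1 in x1 - alpha (x0 + t x1), which is 0; independence gives alpha =
     0 and then 1 = 0. *)
  pose y : 'rV[L]_2 := \row_i (if i == 0 then - alpha else 1 - alpha * t 0 0).
  have y0 : y = 0.
    apply: (row_free_inj Xfree); rewrite mul0mx mul_rV2 !mxE /=.
    rewrite -[RHS]e scaleNr scalerBl scale1r scalerDr scalerA opprD.
    by rewrite addrCA.
  have /eqP := congr1 (fun u : 'rV_2 => u 0 0) y0.
  have /eqP := congr1 (fun u : 'rV_2 => u 0 1) y0.
  rewrite !mxE /= oppr_eq0 => /[swap] /eqP ->.
  by rewrite mul0r subr0 oner_eq0.
have inj_bad : injective (fun t => s2val (bad t)).
  move=> t u; case: (bad t) (bad u) => c /= et nz [c' /= eu _] cE.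
  move: eu; rewrite -cE -et => /addrI /(mulIf nz) tu.
  by apply/matrixP => i j; rewrite !ord1.
(* As [r <= d], the injection of t to c_t is onto, so some c_t is 0; but [z 1] vanishes at 0. *)
have [|t] := inj_onto_base inj_bad _ 0; first by rewrite muln1.
by case: (bad t) => c /= _ + c0; rewrite -c0 /z raddf0 mulmx0 mxE eqxx.
Qed.

Lemma not_minimal_light_pencil (m k n : nat) (hm : d = m) (Gamma : m.-tuple L)
    (hGamma : basis_of {:L} Gamma) (G : 'M[L]_(k, n)) :
  row_free G -> ~ minimal_generator G -> light_pencil G.
Proof.
move=> Gfree /existsNP[x /existsNP[x' /not_implyP[sup /forallNP nprop]]].
(* If [x] were 0, every [a] would kill the codeword of [x'], forcing [x' = 0], a multiple of [x]. *)
have xn0 : x != 0.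
  apply/eqP => x0; case: (nprop 0); rewrite scale0r.
  apply: (row_free_inj Gfree); rewrite mul0mx; apply/rowP => j.
  have := sup (delta_mx j 0); rewrite x0 !mul0mx map_delta_mx -colE.
  by move/(_ erefl)/colP/(_ 0); rewrite !mxE.
(* The [m] rows of [B] span the support of [x *m G]; by the assumed inclusion their [L]-span
   contains the codeword of [x'] as well. *)
pose B := (expansion_mx Gamma (x *m G))^T.
pose X : 'M[L]_(2, k) := col_mx x x'.
have /submxP[Z XG] : (X *m G <= B^L)%MS.
  apply: (row_sub_map (f := in_alg L)) => a /(expansion_mx_ker hGamma) xGa0.
  have -> : X *m G *m a^L = col_mx (x *m G *m a^L) (x' *m G *m a^L).
    by rewrite -!mul_col_mx.
  by rewrite xGa0 (sup a xGa0) col_mx0.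
exists m, B, X, Z; split=> //; first by rewrite hm.
exact: row_free2.
Qed.

(** The messages orthogonal to the subspace form the pencil. Each [K *m y] is [G *m a^L] with [a] in
    the kernel of [B], so [L^(k-2)] injects into that kernel; hence [(k - 2) m <= n - \rank B], that
    is [\rank B <= m]. *)
Lemma light_pencil_of_linear (m k n : nat) (hm : d = m) (Gamma : m.-tuple L)
    (hGamma : basis_of {:L} Gamma) (G : 'M[L]_(k, n)) :
  (2 <= k)%N -> n = ((k - 1) * m)%N -> big_linear_part G -> light_pencil G.
Proof.
move=> k_ge2 nE [K Kfree KU].
have [|N [KN0 Nfree _]] := @right_kernel _ _ _ K^T 2.
  by rewrite (eqP Kfree) subKn.
pose X := N^T; have XK0 : X *m K = 0.
  by apply: trmx_inj; rewrite trmx_mul trmxK KN0 trmx0.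
pose E i := (expansion_mx Gamma (row i (X *m G)))^T.
(* Stacking two expansions gives [2m] rows; a row base of [B] is used in the end, once its rank is
   bounded by [m]. *)
pose B := col_mx (E 0) (E 1).
have kerB (a : 'cV[F]_n) : X *m G *m a^L = 0 <-> B *m a = 0.
  rewrite mul_col_mx; split=> [e | /eqP].
    have e' i : E i *m a = 0.
      by apply/(expansion_mx_ker hGamma); rewrite -row_mul e row0.
    by rewrite !e' col_mx0.
  rewrite col_mx_eq0 => /andP[/eqP e0 /eqP e1].
  by apply: mx2P; rewrite row0 row_mul; apply/(expansion_mx_ker hGamma).
have /submxP[D XG] : (X *m G <= B^L)%MS.
  by apply: (row_sub_map (f := in_alg L)) => a /kerB.
exists (\rank B), (row_base B), X, (D *m (col_base B)^L).
split=> //; last first.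
  by rewrite -mulmxA -map_mxM mulmx_base.
have [N' [_ _ kerN']] := @right_kernel _ _ _ B _ erefl.
have pre (y : 'cV[L]_(k - 2)) : {c | K *m y = G *m (N' *m c)^L}.
  apply: cid; have [a KyE] := KU y.
  have [|c aE] := kerN' a; last by exists c; rewrite -aE.
  by apply/kerB; rewrite -mulmxA -KyE mulmxA XK0 mul0mx.
have /leq_dim_inj : injective (fun y => sval (pre y)).
  move=> y y'; case: (pre y) (pre y') => c /= yE [c' /= y'E] cE.
  by apply: (free_tr_inj Kfree); rewrite /= yE y'E cE.
(* This bound keeps the truncated difference [n - \rank B] exact. *)
have := rank_leq_col B; move: (\rank B) => r; rewrite hm nE.
case: (k) k_ge2 => [|[|k']] // _; rewrite !subSS !subn0 mulSn mulnC.
move=> le_r le_n.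
by rewrite leq_subRL // leq_add2r in le_n.
Qed.

(** The kernel of [B] has dimension at least [n - d = (k - 2) d] over [F], and [G] embeds it in the
    kernel of [X], a copy of [L^(k-2)]. Counting makes this embedding onto, so the kernel of [X]
    lies in U. *)
Lemma linear_of_light_pencil (k n : nat) (G : 'M[L]_(k, n)) :
  (2 <= k)%N -> n = ((k - 1) * d)%N ->
  (forall a : 'cV[F]_n, G *m a^L = 0 -> a = 0) ->
  light_pencil G -> big_linear_part G.
Proof.
move=> k_ge2 nE Ginj [r [B [X [Z [le_rd Xfree XG]]]]].
have [|K [XK0 Kfree kerK]] := @right_kernel _ _ _ X (k - 2).
  by rewrite (eqP Xfree).
exists K => // y.
have [N [BN0 Nfree _]] := @right_kernel _ _ _ B _ erefl.
have pre (c : 'cV[F]_(n - \rank B)) : {u | G *m (N *m c)^L = K *m u}.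
  apply: cid; apply: kerK.
  by rewrite mulmxA XG -mulmxA -map_mxM mulmxA BN0 mul0mx map_mx0 mulmx0.
have inj_pre : injective (fun c => sval (pre c)).
  move=> c c'; case: (pre c) (pre c') => u /= cE [u' /= c'E] uE.
  apply: (free_tr_inj Nfree) => /=; apply/eqP; rewrite -subr_eq0.
  by apply/eqP/Ginj; rewrite map_mxB mulmxBr cE c'E uE subrr.
have [|c ->] := inj_onto_ext inj_pre _ y; last first.
  by exists (N *m c); case: (pre c).
have le_d : (\rank B <= d)%N := leq_trans (rank_leq_row B) le_rd.
move: (\rank B) le_d => s le_d; rewrite nE.
case: (k) k_ge2 => [|[|k']] // _; rewrite !subSS !subn0 mulSn mulnC.
by rewrite addnC -addnBA // leq_addr.
Qed.

End Core.

(** * Codes, supports and the linearity index in terms of a generator matrix *)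

Section Translation.
Variables (F : finFieldType) (L : fieldExtType F).

Lemma generator_matrix_free (k n : nat) (C : {vspace 'rV[L]_n})
    (G : 'M[L]_(k, n)) : generator_matrix C G -> row_free G.
Proof.
move=> /basis_free/free_family Gfree; apply: inj_row_free => x.
by rewrite mulmx_sum_row => /Gfree x0; apply/rowP => i; rewrite x0 mxE.
Qed.

Lemma generator_matrixP (k n : nat) (C : {vspace 'rV[L]_n})
    (G : 'M[L]_(k, n)) (v : 'rV[L]_n) :
  generator_matrix C G -> v \in C <-> exists x, v = x *m G.
Proof.
move=> /span_basis <-; split=> [/memv_span_family[c ->] | [x ->]].
  exists (\row_i c i); rewrite mulmx_sum_row.
  by apply: eq_bigr => i _; rewrite mxE.
by apply/memv_span_family; exists (x 0); rewrite mulmx_sum_row.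
Qed.

Lemma mem_rank_support (n m : nat) (Gamma : m.-tuple L) (v : 'rV[L]_n)
    (w : 'cV[F]_n) :
  w \in rank_support Gamma v <->
  exists c : 'cV[F]_m, w = expansion_mx Gamma v *m c.
Proof.
split=> [/memv_span_family[c ->] | [c ->]].
  exists (\col_j c j); rewrite mulmx_sum_col.
  by apply: eq_bigr => j _; rewrite mxE.
by apply/memv_span_family; exists (fun j => c j 0); rewrite mulmx_sum_col.
Qed.

(** Both supports are column spaces over [F], and a subspace of [F^n] is recovered from its
    orthogonal. *)
Lemma rank_support_subP (n m : nat) (Gamma : m.-tuple L)
    (hGamma : basis_of {:L} Gamma) (v v' : 'rV[L]_n) :
  (rank_support Gamma v' <= rank_support Gamma v)%VS <->
  forall a : 'cV[F]_n, v *m a^L = 0 -> v' *m a^L = 0.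
Proof.
split=> [sub a /(expansion_mx_ker hGamma) va0 | ker].
  apply/(expansion_mx_ker hGamma)/row_matrixP => j.
  rewrite row0 row_mul -tr_col.
  have /mem_rank_support[c ->] : col j (expansion_mx Gamma v') \in
      rank_support Gamma v.
    apply: (subvP sub); apply/mem_rank_support.
    by exists (delta_mx j 0); rewrite colE.
  by rewrite trmx_mul -mulmxA va0 mulmx0.
have : ((expansion_mx Gamma v')^T <= (expansion_mx Gamma v)^T)%MS.
  rewrite -[X in (_ <= X)%MS](map_mx_id (f := idfun)) //.
  apply: (row_sub_map (f := idfun)) => a /(expansion_mx_ker hGamma)/ker.
  by rewrite map_mx_id // => /(expansion_mx_ker hGamma).
case/submxP => D /(congr1 trmx); rewrite trmx_mul !trmxK => ME.
apply/subvP => w /mem_rank_support[c ->]; apply/mem_rank_support.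
by exists (D^T *m c); rewrite mulmxA -ME.
Qed.

Lemma minimal_codeP (k n m : nat) (Gamma : m.-tuple L)
    (hGamma : basis_of {:L} Gamma) (C : {vspace 'rV[L]_n})
    (G : 'M[L]_(k, n)) (hG : generator_matrix C G) :
  minimal_code Gamma C <-> minimal_generator G.
Proof.
split=> [minC x x' ker | minG v v'].
  have memC y : y *m G \in C by apply/(generator_matrixP _ hG); exists y.
  have [alpha] :=
    minC _ _ (memC x) (memC x') ((rank_support_subP hGamma _ _).2 ker).
  rewrite scalemxAl => /(row_free_inj (generator_matrix_free hG)) ->.
  by exists alpha.
move=> /(generator_matrixP _ hG)[x ->] /(generator_matrixP _ hG)[x' ->].
move=> /(rank_support_subP hGamma)/minG[alpha ->].
by exists alpha; rewrite scalemxAl.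
Qed.

(** Such an [a] is orthogonal to the support of every codeword, hence to their sum, which is all of
    [F^n]. *)
Lemma nondegenerate_inj (k n m : nat) (Gamma : m.-tuple L)
    (hGamma : basis_of {:L} Gamma) (C : {vspace 'rV[L]_n})
    (G : 'M[L]_(k, n)) (hG : generator_matrix C G) (a : 'cV[F]_n) :
  rk_nondegenerate Gamma C -> G *m a^L = 0 -> a = 0.
Proof.
move=> Cfull Ga0; pose phi : 'Hom('cV[F]_n, 'M[F]_1) := linfun (mulmx a^T).
have : (fullv <= lker phi)%VS.
  rewrite -Cfull; apply/subv_sumP => v /(generator_matrixP _ hG)[x vE].
  apply/subvP => _ /mem_rank_support[c ->]; rewrite memv_ker lfunE /=.
  rewrite mulmxA -[expansion_mx _ _]trmxK -trmx_mul.
  have -> : (expansion_mx Gamma v)^T *m a = 0.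
    by apply/(expansion_mx_ker hGamma); rewrite vE -mulmxA Ga0 mulmx0.
  by rewrite trmx0 mul0mx.
move=> /subvP ker; apply/colP => i.
have := ker (delta_mx i 0) (memvf _); rewrite memv_ker lfunE /= -colE.
by move/eqP/matrixP/(_ 0 0); rewrite !mxE.
Qed.

Lemma in_col_spanP (k n : nat) (G : 'M[L]_(k, n)) (w : 'cV[L]_k) :
  in_col_span G w <-> exists a : 'cV[F]_n, w = G *m a^L.
Proof.
have mulE (a : 'cV[F]_n) : G *m a^L = \sum_j (a j 0)%:A *: col j G.
  by rewrite mulmx_sum_col; apply: eq_bigr => j _; rewrite mxE.
split=> [[a ->] | [a ->]]; last by exists (fun j => a j 0); rewrite mulE.
by exists (\col_j a j); rewrite mulE; apply: eq_bigr => j _; rewrite mxE.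
Qed.

Lemma big_linear_partP (k n : nat) (G : 'M[L]_(k, n)) :
  big_linear_part G <->
  exists2 H : {vspace 'cV[L]_k}, (forall w, w \in H -> in_col_span G w) &
    (k - 2 <= \dim H)%N.
Proof.
split=> [[K Kfree KU] | [H HU /leq_dimvP[u ufree uH]]].
  exists <<[seq col j K | j : 'I_(k - 2)]>>%VS.
    move=> w /memv_span_family[c ->]; apply/in_col_spanP.
    have [a aE] := KU (\col_j c j); exists a; rewrite -aE mulmx_sum_col.
    by apply: eq_bigr => j _; rewrite mxE.
  apply/leq_dimvP; exists (fun j => col j K).
    move=> c c0 j; have : \col_j c j = 0.
      apply: (free_tr_inj Kfree); rewrite mulmx0 mulmx_sum_col -[RHS]c0.
      by apply: eq_bigr => i _; rewrite mxE.
    by move/colP/(_ j); rewrite !mxE.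
  by move=> j; apply/memv_span/image_f.
pose K : 'M_(k, k - 2) := \matrix_(i, j) u j i 0.
have colK j : col j K = u j by apply/colP => i; rewrite !mxE.
exists K.
  apply: inj_row_free => y /(congr1 trmx); rewrite trmx_mul trmxK trmx0.
  rewrite mulmx_sum_col.
  under eq_bigr do rewrite colK.
  by move/ufree => y0; apply/rowP => j; have := y0 j; rewrite !mxE.
move=> y; apply/in_col_spanP/HU; rewrite mulmx_sum_col.
by apply: rpred_sum => j _; rewrite rpredZ // colK.
Qed.

Lemma linearity_index_ltP (k n : nat) (G : 'M[L]_(k, n)) :
  (linearity_index G < k - 2)%N <-> ~ big_linear_part G.
Proof.
rewrite big_linear_partP; split=> [lt_l [H HU le_H] | no_H].
  have le_k : (\dim H < k.+1)%N.
    by rewrite ltnS (leq_trans (dimvS (subvf H))) // dimvf /dim /= muln1.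
  have : (\dim H <= linearity_index G)%N.
    rewrite /linearity_index (@leq_bigmax_cond _ _ _ (Ordinal le_k)) //.
    by apply/asboolP; exists H.
  by rewrite leqNgt (leq_trans lt_l).
(* For [k <= 2] the truncated difference is 0 and the zero subspace is already a big linear part, so
   both sides of the equivalence fail. *)
have k2_gt0 : (0 < k - 2)%N.
  rewrite lt0n; apply/eqP => k2; apply: no_H; exists 0%VS; last by rewrite k2.
  move=> w; rewrite memv0 => /eqP ->; apply/in_col_spanP.
  by exists 0; rewrite map_mx0 mulmx0.
rewrite -(prednK k2_gt0) ltnS; apply/bigmax_leqP => e /asboolP[H [HU <-]].
rewrite -ltnS prednK // ltnNge; apply/negP => le_H.
by apply: no_H; exists H.
Qed.

(** Over [F], the polynomial X^q - X is the product of all X - a; it vanishes at a fixed point [x],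
    so one of the factors does. *)
Lemma Frobenius_fixed (x : L) : x ^+ #|F| = x -> exists a : F, x = a%:A.
Proof.
move=> xq; have := congr1 (fun p => (map_poly (in_alg L) p).[x])
  (finField_genPoly F).
rewrite rmorphB /= map_polyXn map_polyX hornerD hornerN hornerXn hornerX xq.
rewrite subrr rmorph_prod horner_prod => /esym/eqP/prodf_eq0[a _].
rewrite rmorphB /= map_polyX map_polyC hornerXsubC subr_eq0 => /eqP ->.
by exists a.
Qed.

Lemma frobD (x y : L) : (x + y) ^+ #|F| = x ^+ #|F| + y ^+ #|F|.
Proof.
have [p pr_p pcharF] := finPcharP F.
have pcharL : p \in [pchar L] by rewrite pchar_lalg.
apply: exprDn_pchar.
rewrite (eq_pnat _ (pcharf_eq pcharL)).
by rewrite (card_pprimeChar pcharF) pnatX pnat_id.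
Qed.

End Translation.

(** * Frobenius-stable subspaces and the second generalized rank weight *)

Section Frobenius.
Variables (F : finFieldType) (L : fieldExtType F).

Lemma frobM_base (r n : nat) (z : 'rV[L]_r) (B : 'M[F]_(r, n)) :
  frob_row (z *m B^L) = frob_row z *m B^L.
Proof.
apply/rowP => j; rewrite !mxE.
have expS (I : Type) (s : seq I) (f : I -> L) :
    (\sum_(i <- s) f i) ^+ #|F| = \sum_(i <- s) f i ^+ #|F|.
  elim/big_rec2: _ => [|i x y _ <-]; last exact: frobD.
  by rewrite expr0n; case: #|F| (card_field_gt1 F).
rewrite expS; apply: eq_bigr => i _; rewrite !mxE exprMn.
by rewrite -rmorphXn /= expf_card.
Qed.

Lemma frob_row_onto (n : nat) (w : 'rV[L]_n) : exists z, w = frob_row z.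
Proof.
(* Raising to the power [#|F| ^ \dim {:L}] is the identity on [L], so one exponent less inverts the
   Frobenius. *)
exists (map_mx (fun x => x ^+ (#|F| ^ (\dim {:L}).-1)) w).
apply/rowP => j; rewrite !mxE -exprM -expnSr prednK ?adim_gt0 //.
by rewrite -card_ext (@expf_card (finvect_type L)).
Qed.

(* Galois descent for the Frobenius: the reduced echelon basis of a stable
   subspace is itself fixed, hence has its entries in F. *)
Lemma Frobenius_descent (n : nat) (V : {vspace 'rV[L]_n}) :
  Frobenius_closed V ->
  exists B : 'M[F]_(\dim V, n), forall v, v \in V -> exists z, v = z *m B^L.
Proof.
move=> Vfrob; set d := \dim V.
pose A : 'M_(d, n) := \matrix_i (vbasis V)`_i.
have AV v : v \in V <-> exists z, v = z *m A.
  split=> [/coord_vbasis vE | [z ->]].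
    exists (\row_i coord (vbasis V) i v); rewrite mulmx_sum_row {1}vE.
    by apply: eq_bigr => i _; rewrite rowK mxE.
  rewrite mulmx_sum_row; apply: rpred_sum => i _; rewrite rowK rpredZ //.
  by apply/vbasis_mem/mem_nth; rewrite size_tuple.
have Afull : row_full A^T.
  rewrite /row_full mxrank_tr; apply: inj_row_free => z.
  rewrite mulmx_sum_row; under eq_bigr do rewrite rowK.
  move/(freeP (basis_free (vbasisP V))) => z0.
  by apply/rowP => i; rewrite z0 mxE.
(* [g] selects pivot columns, on which [A] is the invertible matrix [D]; dividing by [D] makes [A']
   the identity there. *)
pose g := fullrankfun Afull; pose D := colsub g A.
have Dunit : D \in unitmx by rewrite -unitmx_tr trmx_mxsub fullrowsub_unit.
pose A' := invmx D *m A.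
have A'1 : colsub g A' = 1%:M by rewrite -mulmx_colsub mulVmx.
have A'V v : v \in V <-> exists z, v = z *m A'.
  rewrite AV; split=> [][z ->]; last by exists (z *m invmx D); rewrite mulmxA.
  by exists (z *m D); rewrite mulmxA mulmxK.
(* The Frobenius image of a row stays in [V], and a vector of [V] is determined by its columns in
   [g]; there the row is a unit vector, which the Frobenius fixes. *)
have fixA i : frob_row (row i A') = row i A'.
  have /A'V[z zE] : frob_row (row i A') \in V.
    apply/Vfrob; exists (row i A') => //; apply/A'V.
    by exists (delta_mx 0 i); rewrite rowE.
  rewrite zE [in RHS]rowE; congr (_ *m _); apply/rowP => j.
  have /rowP/(_ j) := congr1 (colsub g) zE.
  rewrite -mulmx_colsub A'1 mulmx1 => <-.
  have /matrixP/(_ i j) := A'1; rewrite !mxE => ->.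
  rewrite eqxx eq_sym; case: (j == i) => /=; first by rewrite expr1n.
  by rewrite expr0n; case: #|F| (card_field_gt1 F).
have entry i j : {a : F | A' i j = a%:A}.
  apply: cid; apply: Frobenius_fixed.
  by have /rowP/(_ j) := fixA i; rewrite !mxE.
exists (\matrix_(i, j) sval (entry i j)) => v /A'V[z ->]; exists z.
congr (_ *m _); apply/matrixP => i j; rewrite 2![in RHS]mxE.
by case: (entry i j).
Qed.

(** A light pencil lies in the [L]-span of the rows of [B], which is stable because [B] has entries
    in [F]; conversely, descent supplies such a [B] for any stable subspace. *)
Lemma gen_rank_weight_gtP (k n : nat) (C : {vspace 'rV[L]_n})
    (G : 'M[L]_(k, n)) (hG : generator_matrix C G) :
  (2 <= k)%N ->
  (\dim {:L} < gen_rank_weight 2 C)%N <-> ~ light_pencil G.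
Proof.
move=> k_ge2; split=> [lt_w [r [B [X [Z [le_r Xfree XG]]]]] | no_light].
  pose V := limg (linfun (mulmxr B^L : 'rV[L]_r -> 'rV[L]_n)).
  have VP w : w \in V <-> exists z, w = z *m B^L.
    split=> [/memv_imgP[z _ ->] | [z ->]]; first by exists z; rewrite lfunE.
    by apply/memv_imgP; exists z; rewrite ?memvf // lfunE.
  have le_V : (\dim V <= r)%N.
    have := limg_ker_dim (linfun (mulmxr B^L : 'rV[L]_r -> 'rV[L]_n)) fullv.
    by rewrite dimvf /dim /= mul1n => <-; rewrite leq_addl.
  have Vfrob : Frobenius_closed V.
    move=> w; split=> [/VP[z ->] | [v /VP[z ->] ->]]; last first.
      by apply/VP; exists (frob_row z); rewrite frobM_base.
    have [z' ->] := frob_row_onto z.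
    exists (z' *m B^L); last by rewrite frobM_base.
    by apply/VP; exists z'.
  have VC2 : (2 <= \dim (V :&: C))%N.
    apply/leq_dimvP; exists (fun i => row i (X *m G)) => [c | i].
      have -> : \sum_i c i *: row i (X *m G) = (\row_i c i) *m X *m G.
        by rewrite -mulmxA mulmx_sum_row; apply: eq_bigr => i _; rewrite mxE.
      move=> c0 i; have /rowP/(_ i) : \row_i c i = 0; last by rewrite !mxE.
      apply: (row_free_inj Xfree).
      apply: (row_free_inj (generator_matrix_free hG)).
      by rewrite c0 !mul0mx.
    rewrite memv_cap; apply/andP; split; last first.
      by apply/(generator_matrixP _ hG); exists (row i X); rewrite row_mul.
    by apply/VP; exists (row i Z); rewrite XG row_mul.
  have le_n : (\dim V < n.+1)%N.
    by rewrite ltnS (leq_trans (dimvS (subvf V))) // dimvf /dim /= mul1n.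
  have : (gen_rank_weight 2 C <= \dim V)%N.
    apply: (@Order.TotalTheory.bigmin_inf _ nat _ _ (Ordinal le_n)) => //.
    by apply/asboolP; exists V.
  by rewrite leqNgt (leq_ltn_trans (leq_trans le_V le_r)).
apply: (introT (@Order.TotalTheory.bigmin_gtP _ nat _ _ _ _ _)); split.
  (* The default value [n] of the minimum must exceed the degree too: otherwise [B = 1] makes the
     pencil of the first two rows of [G] light. *)
  rewrite ltEnat /= ltnNge; apply/negP => le_n; apply: no_light.
  exists n, 1%:M, (pid_mx 2), (pid_mx 2 *m G); split=> //.
    by rewrite /row_free rank_pid_mx.
  by rewrite map_mx1 mulmx1.
move=> e /asboolP[V [Vfrob /leq_dimvP[u ufree uVC] <-]].
rewrite ltEnat /= ltnNge; apply/negP => le_V; apply: no_light.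
have [B BV] := Frobenius_descent Vfrob.
have preB i : {z | u i = z *m B^L}.
  by apply: cid; apply: BV; have := uVC i; rewrite memv_cap => /andP[].
have preG i : {x | u i = x *m G}.
  apply: cid; apply/(generator_matrixP _ hG).
  by have := uVC i; rewrite memv_cap => /andP[].
exists (\dim V), B, (\matrix_i sval (preG i)), (\matrix_i sval (preB i)).
have XGE : (\matrix_i sval (preG i)) *m G = \matrix_i u i.
  by apply/row_matrixP => i; rewrite row_mul !rowK; case: (preG i).
split=> //.
  apply: inj_row_free => y /(congr1 (mulmx^~ G)).
  rewrite mul0mx -mulmxA XGE mulmx_sum_row; under eq_bigr do rewrite rowK.
  by move/ufree => y0; apply/rowP => i; rewrite y0 mxE.
rewrite XGE; apply/row_matrixP => i; rewrite row_mul !rowK.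
by case: (preB i).
Qed.

End Frobenius.

Theorem corollary6p19 (F : finFieldType) (L : fieldExtType F) (m k : nat)
    (hm : \dim {:L} = m) (hk : (2 <= k)%N)
    (Gamma : m.-tuple L) (hGamma : basis_of {:L} Gamma)
    (C : {vspace 'rV[L]_((k - 1) * m)}) (hdim : \dim C = k)
    (hC : rk_nondegenerate Gamma C)
    (G : 'M[L]_(k, (k - 1) * m)) (hG : generator_matrix C G) :
  (minimal_code Gamma C <-> (linearity_index G < k - 2)%N) /\
  ((linearity_index G < k - 2)%N <-> (m < gen_rank_weight 2 C)%N).
Proof.
(* The length [(k - 1) * m] enters in both directions, nondegeneracy in the one from pencils to
   subspaces. *)
have linP : light_pencil G <-> big_linear_part G.
  split; last exact: (light_pencil_of_linear hm hGamma hk erefl).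
  apply: linear_of_light_pencil => //; first by rewrite hm.
  by move=> a; apply: nondegenerate_inj hC.
have minP : minimal_generator G <-> ~ light_pencil G.
  split=> [minG light | no_light].
    exact: light_pencil_not_minimal light minG.
  apply: contrapT => nmin; apply: no_light.
  exact: (not_minimal_light_pencil hm hGamma (generator_matrix_free hG)).
have weightP : (m < gen_rank_weight 2 C)%N <-> ~ light_pencil G.
  by rewrite -(gen_rank_weight_gtP hG hk) hm.
by rewrite (minimal_codeP hGamma hG) minP linearity_index_ltP weightP linP.
Qed.
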